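(* Let $n\ge 1$ and let $x_1,\dots,x_n,y_1,\dots,y_n$ be commuting indeterminates. Then $$\sum_{\pi \in \mathfrak{D}_n} (-1)^{\mathrm{inv}(\pi)}\, \mathbf{x}_{\mathrm{RLMv}(\pi)}\, \mathbf{y}_{\mathrm{EXCv}(\pi)} = (-1)^{n-1} \sum_{j=1}^{n-1} x_1 \cdots x_j \cdot y_{j+1}\cdots y_{n}.$$ Moreover, $$\sum_{\pi \in \mathfrak{D}_n} (-1)^{\mathrm{inv}(\pi)}\, \mathbf{x}_{\mathrm{RLMi}(\pi)}\, \mathbf{y}_{\mathrm{EXCi}(\pi)} = (-1)^{n-1} \sum_{j=1}^{n-1} y_1 \cdots y_j \cdot x_{j+1}\cdots x_{n}.$$
   Context: $[n]=\{1,\dots,n\}$; $\mathfrak{S}_n$ is the symmetric group on $[n]$; $\mathfrak{D}_n$ is the set of derangements, i.e. permutations $\pi\in\mathfrak{S}_n$ with $\pi(i)\neq i$ for all $i$. For $\pi\in\mathfrak{S}_n$: $\mathrm{inv}(\pi)$ is the number of pairs $i<j$ with $\pi(i)>\pi(j)$; $\mathrm{EXCi}(\pi)=\{j\in[n]:\pi(j)>j\}$; $\mathrm{EXCv}(\pi)=\{\pi(j):j\in\mathrm{EXCi}(\pi)\}$; $\mathrm{RLMi}(\pi)=\{i\in[n]:\pi(i)<\pi(j)\text{ for all }j\in\{i+1,\dots,n\}\}$; $\mathrm{RLMv}(\pi)=\{\pi(i):i\in\mathrm{RLMi}(\pi)\}$. For a finite set $S$ of positive integers, $\mathbf{x}_S=\prod_{s\in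 S}x_s$ and $\mathbf{y}_S=\prod_{s\in S}y_s$, with $\mathbf{x}_\emptyset=\mathbf{y}_\emptyset=1$. *)

(* Defs.v *)
From HB Require Import structures.
From mathcomp Require Import all_boot all_order all_algebra all_fingroup.
From mathcomp Require Import mpoly.

Set Implicit Arguments.
Unset Strict Implicit.
Unset Printing Implicit Defensive.

Import GRing.Theory.
Local Open Scope ring_scope.

(* 'I_n stands for [n] with indices shifted by one: i : 'I_n is the integer
   i + 1.  The definitions below only compare elements of [n], so they commute
   with the shift. *)

Section PermutationStatistics.
Variable n : nat.
Implicit Types (s : 'S_n) (i j : 'I_n).

Definition derangements : {set 'S_n} :=
  [set s : 'S_n | [forall i, s i != i]].

Definition inv_number s : nat :=
  #|[set p : 'I_n * 'I_n | (p.1 < p.2)%N && (s p.2 < s p.1)%N]|.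

Definition EXCi s : {set 'I_n} := [set j : 'I_n | (j < s j)%N].

Definition EXCv s : {set 'I_n} := [set s j | j in EXCi s].

Definition RLMi s : {set 'I_n} :=
  [set i : 'I_n | [forall j : 'I_n, (i < j)%N ==> (s i < s j)%N]].

Definition RLMv s : {set 'I_n} := [set s i | i in RLMi s].

End PermutationStatistics.

(* The 2n indeterminates x_1, ..., x_n, y_1, ..., y_n are the generators of the
   polynomial ring in n + n variables: Xvar R i is x_(i+1) and Yvar R i is
   y_(i+1). *)

Section Indeterminates.
Variables (R : comNzRingType) (n : nat).

Definition Xvar (i : 'I_n) : {mpoly R[n + n]} := 'X_(lshift n i).

Definition Yvar (i : 'I_n) : {mpoly R[n + n]} := 'X_(rshift n i).

Definition Xmon (S : {set 'I_n}) : {mpoly R[n + n]} := \prod_(i in S) Xvar i.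

Definition Ymon (S : {set 'I_n}) : {mpoly R[n + n]} := \prod_(i in S) Yvar i.

End Indeterminates.

(* Main.v *)
(** The pair (RLMi, EXCi) carries the content: s |-> w s^-1 w, with w the reversal
    of [n], maps it to the mirror images of (RLMv, EXCv) and preserves sign and
    derangements, so the first identity is the second one with both families of
    variables reversed.

    For the second identity, enlarge the derangements to the permutations whose
    only possible fixed point is n, and leave the factor x_n, which is always
    present, out of the weight.  Swapping the values n-1 and n is then a
    weight-preserving, sign-reversing involution on the permutations with
    s(n-1) != n.  The remaining ones, with s(n-1) = n, lose a factor -y_(n-1)
    when position n-1 and value n are deleted, so by induction the enlarged sum
    is (-1)^(n-1) y_1 ... y_(n-1).  Those with s(n) = n are derangements of
    [n-1] with n appended, so subtracting them yields
    A_n = (-1)^(n-1) x_n y_1 ... y_(n-1) - x_n A_(n-1), which the right-hand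
    side satisfies too. *)

Require Import Defs.
From HB Require Import structures.
From mathcomp Require Import all_boot all_order all_algebra all_fingroup.
From mathcomp Require Import mpoly.
From mathcomp Require Import zify ring.

Set Implicit Arguments.
Unset Strict Implicit.
Unset Printing Implicit Defensive.

Import GRing.Theory.
Local Open Scope ring_scope.

(** * Removing a position and its value from a permutation *)

(** A sigma type rather than an existential: [sval] supplies the inverse map when [big_lift_perm]
    reindexes. *)
Lemma lift_perm_surj n (i : 'I_n.+1) (s : 'S_n.+1) :
  {t : 'S_n | s = lift_perm i (s i) t}.
Proof.
pose f k := odflt k (unlift (s i) (s (lift i k))).
have fK k : lift (s i) (f k) = s (lift i k).
  rewrite /f; have := neq_lift i k.
  by rewrite -(inj_eq (@perm_inj _ s)) => /unlift_some [? ? ->].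
have f_inj : injective f.
  by move=> k l /(congr1 (lift (s i))); rewrite !fK => /perm_inj /lift_inj.
exists (perm f_inj); apply/permP => k.
case: (unliftP i k) => [l|] ->; last by rewrite lift_perm_id.
by rewrite lift_perm_lift permE fK.
Qed.

Lemma lift_perm_inj n (i j : 'I_n.+1) : injective (lift_perm i j).
Proof.
move=> s t st; apply/permP => k; apply: (@lift_inj _ j).
by rewrite -!(lift_perm_lift i) st.
Qed.

Lemma big_lift_perm (R : Type) (idx : R) (op : Monoid.com_law idx) n
    (i j : 'I_n.+1) (P : pred 'S_n.+1) (F : 'S_n.+1 -> R) :
  \big[op/idx]_(s | P s && (s i == j)) F s =
  \big[op/idx]_(t | P (lift_perm i j t)) F (lift_perm i j t).
Proof.
rewrite (reindex_onto (lift_perm i j) (fun s => sval (lift_perm_surj i s))).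
  apply: eq_bigl => t; case: lift_perm_surj => u /=.
  by rewrite lift_perm_id => /lift_perm_inj ->; rewrite !eqxx !andbT.
by move=> s /andP[_ /eqP <-]; case: lift_perm_surj.
Qed.

(** * Inversions and the sign *)

Lemma inv_numberE n (s : 'S_n) :
  inv_number s = (\sum_(i < n) \sum_(j < n) ((i < j) && (s j < s i)))%N.
Proof.
rewrite /inv_number -sum1_card pair_big /= big_mkcond /=.
by apply: eq_bigr => p _; rewrite inE; case: ifP.
Qed.

(** Insertion preserves the order of the old entries, and the new last entry [j] is inverted exactly
    with the [n - j] values above it. *)
Lemma inv_number_lift_perm n (j : 'I_n.+1) (t : 'S_n) :
  inv_number (lift_perm ord_max j t) = (inv_number t + (n - j))%N.
Proof.
have widenE (k : 'I_n) : widen_ord (leqnSn n) k = lift ord_max k.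
  by apply: val_inj; rewrite /= /bump leqNgt ltn_ord.
rewrite !inv_numberE big_ord_recr /= [X in (_ + X)%N]big1 => [|k _]; last first.
  by rewrite ltnNge -ltnS ltn_ord.
rewrite addn0; under eq_bigr => i _ do rewrite big_ord_recr /=.
rewrite big_split /=; congr (_ + _)%N.
  apply: eq_bigr => i _; apply: eq_bigr => k _.
  rewrite !widenE !lift_perm_lift /= !/bump.
  by congr (nat_of_bool (_ && _)); lia.
under eq_bigr => i _ do rewrite ltn_ord widenE lift_perm_id lift_perm_lift /=.
rewrite -(reindex_inj (@perm_inj _ t) (P := predT)
  (F := fun i : 'I_n => nat_of_bool (j < bump j i)%N)) /=.
have -> : (\sum_(i < n) (j < bump j i) = \sum_(j <= i < n) 1)%N.
  rewrite (big_nat_widenl j 0) // big_mkord [RHS]big_mkcond.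
  apply: eq_bigr => i _; rewrite /bump; case: (leqP j i) => [|/ltnW] h /=.
    by rewrite add1n ltnS h.
  by rewrite add0n ltnNge h.
by rewrite sum_nat_const_nat muln1.
Qed.

(** Removing the last position lowers [inv_number] by [n - j], which has the parity of [n + j], the
    change of sign in [odd_lift_perm]. *)
Lemma odd_inv_number n (s : 'S_n) : odd (inv_number s) = s.
Proof.
elim: n s => [|n IHn] s.
  rewrite [s](_ : _ = 1%g) ?odd_perm1; last by apply/permP => -[].
  by rewrite inv_numberE big_ord0.
case: (lift_perm_surj ord_max s) => t ->.
rewrite inv_number_lift_perm odd_lift_perm oddD IHn.
by rewrite oddB 1?addbC // -ltnS ltn_ord.
Qed.

Lemma sum_sign_reversing (R : zmodType) n (P : pred 'S_n) (F : 'S_n -> R)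
    (t : 'S_n) :
  odd_perm t -> involutive (fun s => s * t)%g ->
  (forall s, P s -> P (s * t)%g) -> (forall s, P s -> F (s * t)%g = - F s) ->
  \sum_(s | P s) F s = 0.
Proof.
(* Even and odd permutations are paired off: S = - S would not give S = 0, as R
   may have 2-torsion. *)
move=> odd_t tK Pt Ft; rewrite (bigID (@odd_perm _)) /=.
rewrite (reindex_inj (inv_inj tK)) /=.
have PtE s : P (s * t)%g = P s.
  by apply/idP/idP => [/Pt|/Pt//]; rewrite tK.
under eq_bigl => s do rewrite PtE odd_permM odd_t addbT.
under eq_bigr => s /andP[Ps _] do rewrite Ft //.
by rewrite sumrN addNr.
Qed.

(** * Permutations that may fix only the last point *)

Definition quasi_derangements n : {set 'S_n.+1} :=
  [set s : 'S_n.+1 | [forall i, (s i == i) ==> (i == ord_max)]].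

Lemma quasi_derangementsP n (s : 'S_n.+1) :
  reflect (forall i, s i = i :> nat -> i = n :> nat) (s \in quasi_derangements n).
Proof.
rewrite inE; apply: (iffP forallP) => [qs i /val_inj /eqP sii|qs i].
  by have := qs i; rewrite sii => /eqP ->.
by apply/implyP => /eqP sii; apply/eqP/val_inj/qs; rewrite sii.
Qed.

Lemma ord_max_RLMi n (s : 'S_n.+1) : ord_max \in RLMi s.
Proof.
by rewrite inE; apply/forallP => j; rewrite ltnNge -ltnS ltn_ord.
Qed.

(** * Swapping the two largest values *)

Section TopSwap.
Variable n : nat.

(* The penultimate index. *)
Let pen : 'I_n.+2 := inord n.
Let pen_val : pen = n :> nat. Proof. by rewrite inordK. Qed.

Definition top_tperm : 'S_n.+2 := tperm pen ord_max.

Lemma odd_top_tperm : odd_perm top_tperm.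
Proof. by rewrite odd_tperm -val_eqE /= pen_val; lia. Qed.

Lemma top_tperm_cases (v : 'I_n.+2) :
  [\/ (v : nat) = n /\ (top_tperm v : nat) = n.+1,
      (v : nat) = n.+1 /\ (top_tperm v : nat) = n |
      (v < n)%N /\ (top_tperm v : nat) = v].
Proof.
rewrite /top_tperm; case: tpermP => [->|->|/eqP vp /eqP vm].
- by constructor 1.
- by constructor 2.
constructor 3; split=> //; move: vp vm; rewrite -!val_eqE /= pen_val.
by have := ltn_ord v; lia.
Qed.

Section Swap.
Variable s : 'S_n.+2.
Hypothesis sq : s \in quasi_derangements n.+1.
Hypothesis s_pen : s pen != ord_max.

Let fix_max i : s i = i :> nat -> i = n.+1 :> nat.
Proof. exact: (quasi_derangementsP s sq). Qed.

(** The value at position [n] is neither [n], since only the last point may be fixed, nor [n.+1], by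
    [s_pen]. *)
Let s_pen_lt (i : 'I_n.+2) : i = n :> nat -> (s i < n)%N.
Proof.
move=> i_n; have -> : i = pen by apply: val_inj; rewrite /= i_n pen_val.
have := s_pen; have := fix_max (i := pen); have := ltn_ord (s pen).
by rewrite -val_eqE /= pen_val; lia.
Qed.

Lemma top_swap_quasi : (s * top_tperm)%g \in quasi_derangements n.+1.
Proof.
apply/quasi_derangementsP => i; rewrite permM.
have := @fix_max i; have := @s_pen_lt i; have := ltn_ord i.
by have [] := top_tperm_cases (s i) => -[]; lia.
Qed.

Lemma top_swap_pen : (s * top_tperm)%g pen != ord_max.
Proof.
rewrite -val_eqE /= permM; have := s_pen_lt pen_val.
by have [] := top_tperm_cases (s pen) => -[]; lia.
Qed.

(** Exchanging the values [n] and [n.+1] could alter an excedance only at position [n], where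
    [s_pen_lt] puts the value below both. *)
Lemma EXCi_top_swap : EXCi (s * top_tperm)%g = EXCi s.
Proof.
apply/setP => i; rewrite !inE permM.
have := @fix_max i; have := @s_pen_lt i; have := ltn_ord i.
by have [] := top_tperm_cases (s i) => -[]; lia.
Qed.

(** A minimum to the left of [pen] has a value below [s pen], itself below [n]. So the swap moves no
    value at a minimum before the last position. *)
Lemma RLMi_top_lt i : i \in RLMi s -> i != ord_max -> (s i < n)%N.
Proof.
rewrite inE -val_eqE /= => /forallP rlm i_max.
have := fix_max (i := i); have := ltn_ord i; have := ltn_ord (s i).
have := implyP (rlm ord_max) => /=; have := implyP (rlm pen); rewrite pen_val.
have := ltn_ord (s ord_max); have := s_pen_lt pen_val; have := @s_pen_lt i.
by lia.
Qed.

End Swap.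

Lemma RLMi_top_swap (s : 'S_n.+2) :
  s \in quasi_derangements n.+1 -> s pen != ord_max ->
  RLMi (s * top_tperm)%g = RLMi s.
Proof.
(* The swapped permutation satisfies the same hypotheses, so [RLMi_top_lt] serves both
   inclusions. *)
move=> sq sp; have sq' := top_swap_quasi sq sp; have sp' := top_swap_pen sq sp.
apply/setP => i; case: (eqVneq i ord_max) => [->|i_max].
  by rewrite !ord_max_RLMi.
apply/idP/idP => iR.
  have := RLMi_top_lt sq' sp' iR i_max; move: iR; rewrite !inE permM.
  move=> /forallP iR lt_n; apply/forallP => j; apply/implyP => ij.
  have := implyP (iR j) ij; rewrite !permM; move: lt_n.
  by have [] := top_tperm_cases (s i) => -[];
    have [] := top_tperm_cases (s j) => -[]; lia.
have := RLMi_top_lt sq sp iR i_max; move: iR; rewrite !inE.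
move=> /forallP iR lt_n; apply/forallP => j; apply/implyP => ij.
have := implyP (iR j) ij; rewrite !permM; move: lt_n.
by have [] := top_tperm_cases (s i) => -[];
  have [] := top_tperm_cases (s j) => -[]; lia.
Qed.

End TopSwap.

(** * Effect of inserting the maximal value *)

Lemma bump_ord n (k : 'I_n) : bump n k = k.
Proof. exact: lift_max k. Qed.

(** The inserted value exceeds all others, so it cannot destroy a minimum, and the rest keep their
    relative order. *)
Lemma RLMi_lift_perm_max n (i : 'I_n.+1) (t : 'S_n) k :
  (lift i k \in RLMi (lift_perm i ord_max t)) = (k \in RLMi t).
Proof.
have bump_lt m (a : nat) (b : nat) : (bump m a < bump m b)%N = (a < b)%N.
  by rewrite !ltnNge leq_bump2.
rewrite !inE; apply/forallP/forallP => rlm j.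
  by have := rlm (lift i j); rewrite !lift_perm_lift !lift_max /= bump_lt.
case: (unliftP i j) => [l|] ->.
  by rewrite !lift_perm_lift !lift_max /= bump_lt.
by rewrite lift_perm_lift lift_perm_id lift_max /= ltn_ord implybT.
Qed.

Lemma RLMi_lift_perm_id n (i : 'I_n.+1) (t : 'S_n) :
  (i \in RLMi (lift_perm i ord_max t)) = (i == ord_max).
Proof.
rewrite inE; apply/forallP/eqP => [/(_ ord_max)|->] /=.
  rewrite lift_perm_id /=; set m := lift_perm _ _ _ _ => /implyP ni.
  by apply: val_inj => /=; have := ltn_ord i; have := ltn_ord m; lia.
by move=> j; rewrite ltnNge -ltnS ltn_ord.
Qed.

Lemma derangementsE n (s : 'S_n.+1) :
  (s \in derangements n.+1) =
  (s \in quasi_derangements n) && (s ord_max != ord_max).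
Proof.
rewrite !inE; apply/forallP/andP => [der|[/forallP q sm] i].
  by split=> //; apply/forallP => i; rewrite (negbTE (der i)).
apply/negP => sii; case/negP: sm.
by have := q i; rewrite sii => /eqP <-.
Qed.

Lemma lift_perm_max_quasi n (t : 'S_n.+1) :
  (lift_perm ord_max ord_max t \in quasi_derangements n.+1) =
  (t \in derangements n.+1).
Proof.
rewrite !inE; apply/forallP/forallP => [q k|der i].
  have := q (lift ord_max k).
  rewrite lift_perm_lift (inj_eq lift_inj) [_ == ord_max]eq_sym.
  by rewrite (negbTE (neq_lift _ _)) implybF.
case: (unliftP ord_max i) => [k|] ->; last by rewrite eqxx implybT.
by rewrite lift_perm_lift (inj_eq lift_inj) (negbTE (der k)).
Qed.

(** Positions below [n] keep their index and value, the last position is exempt on both sides, and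
    the new position [n] carries [n.+1]. *)
Lemma lift_perm_pen_quasi n (t : 'S_n.+1) :
  (lift_perm (inord n) ord_max t \in quasi_derangements n.+1) =
  (t \in quasi_derangements n).
Proof.
set p : 'I_n.+2 := inord n.
have pE : p = n :> nat by rewrite inordK.
apply/quasi_derangementsP/quasi_derangementsP => q k.
  have := q (lift p k); rewrite lift_perm_lift lift_max /= /bump pE.
  by case: leqP => h; have := ltn_ord k; lia.
case: (unliftP p k) => [j|] ->.
  have := q j; rewrite lift_perm_lift lift_max /= /bump pE.
  by have := ltn_ord (t j); have := ltn_ord j; case: leqP => h; lia.
by rewrite lift_perm_id pE /=; lia.
Qed.

(** * Signed weights and their recurrences *)

Section Weights.
Variables (R : comNzRingType) (x y : nat -> R).

(** The variables are indexed by [nat], so that the same families serve every size in the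
    inductions. *)
Definition weight n (s : 'S_n) : R :=
  (-1) ^+ s * (\prod_(i in RLMi s) x i) * (\prod_(i in EXCi s) y i).

(** Inserting a position before the last one shifts the index of the last; omitting its factor keeps
    the recurrence below free of [x]. *)
Definition core_weight n (s : 'S_n.+1) : R :=
  (-1) ^+ s * (\prod_(i in RLMi s | i != ord_max) x i) *
  (\prod_(i in EXCi s) y i).

Lemma weight_core n (s : 'S_n.+1) : weight s = x n * core_weight s.
Proof.
rewrite /core_weight /weight [in X in X * _](bigD1 ord_max) ?ord_max_RLMi //=.
by rewrite -!mulrA mulrCA.
Qed.

Lemma weight_lift_perm_max n (t : 'S_n) :
  weight (lift_perm ord_max ord_max t) = x n * weight t.
Proof.
rewrite /weight odd_lift_perm addbb addFb.
rewrite [X in _ * X * _ = _](bigD1_ord ord_max) ?ord_max_RLMi //=.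
have -> : \prod_(i in EXCi (lift_perm ord_max ord_max t)) y i =
          \prod_(i in EXCi t) y i.
  rewrite big_mkcond (bigD1_ord ord_max) //= inE lift_perm_id ltnn mul1r.
  rewrite [RHS]big_mkcond; apply: eq_bigr => k _.
  by rewrite !inE lift_perm_lift !lift_max bump_ord.
under eq_bigl => k do rewrite RLMi_lift_perm_max.
under eq_bigr => k _ do rewrite bump_ord.
by rewrite -!mulrA mulrCA.
Qed.

(** The sign comes from the odd sum of the new position [n] and its value [n.+1]. That position is
    an excedance, whence [y n], but not a right-to-left minimum. *)
Lemma core_weight_lift_perm_pen n (t : 'S_n.+1) :
  core_weight (lift_perm (inord n) ord_max t) = - y n * core_weight t.
Proof.
set p : 'I_n.+2 := inord n; rewrite /core_weight.
have pE : p = n :> nat by rewrite inordK.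
rewrite odd_lift_perm pE /= addbN addbb /=.
have -> : \prod_(i in EXCi (lift_perm p ord_max t)) y i =
          y n * \prod_(i in EXCi t) y i.
  rewrite big_mkcond (bigD1_ord p) //= inE lift_perm_id pE leqnn; congr (_ * _).
  rewrite [RHS]big_mkcond; apply: eq_bigr => k _.
  rewrite !inE lift_perm_lift lift_max /= pE /bump.
  have := ltn_ord (t k); have := ltn_ord k.
  case: (leqP n k) => h; last by rewrite add0n.
  by move=> kn tn; rewrite !ifF //; lia.
have -> : \prod_(i in RLMi (lift_perm p ord_max t) | i != ord_max) x i =
          \prod_(i in RLMi t | i != ord_max) x i.
  rewrite big_mkcond (bigD1_ord p) //= RLMi_lift_perm_id -val_eqE /= pE.
  rewrite ltn_eqF //= mul1r [RHS]big_mkcond; apply: eq_bigr => k _.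
  rewrite RLMi_lift_perm_max -!val_eqE /= pE /bump.
  case: (leqP n k) => h; last by rewrite add0n !ltn_eqF // ltnW.
  have -> : k = n :> nat by apply/eqP; rewrite eqn_leq h -ltnS ltn_ord.
  by rewrite add1n !eqxx !andbF.
by case: (t : bool); ring.
Qed.

Lemma sum_core_weight n :
  \sum_(s in quasi_derangements n) core_weight s =
  (-1) ^+ n * \prod_(0 <= i < n) y i.
Proof.
elim: n => [|n IHn].
  rewrite (big_pred1 1%g) => [|s].
    rewrite /core_weight odd_perm1.
    rewrite big_pred0 => [|i]; last by rewrite ord1 andbC.
    rewrite big_pred0 => [|i]; last by rewrite inE perm1 ltnn.
    by rewrite big_geq // !mulr1.
  have -> : s = 1%g by apply/permP => i; rewrite !ord1.
  rewrite /= eqxx.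
  by apply/quasi_derangementsP => i; rewrite ord1.
rewrite (bigID (fun s : 'S_n.+2 => s (inord n) == ord_max)) /=.
rewrite [X in _ + X](sum_sign_reversing (odd_top_tperm n))
  => [||s /andP[sq sp]|s /andP[sq sp]].
- rewrite addr0.
  rewrite (big_lift_perm _ (inord n) ord_max (mem (quasi_derangements n.+1))) /=.
  under eq_bigl => t do rewrite lift_perm_pen_quasi.
  under eq_bigr => t _ do rewrite core_weight_lift_perm_pen.
  by rewrite -big_distrr /= IHn big_nat_recr //= exprS; ring.
- by move=> s; rewrite -mulgA tperm2 mulg1.
- by rewrite top_swap_quasi // top_swap_pen.
rewrite /core_weight EXCi_top_swap // RLMi_top_swap // odd_permM odd_top_tperm.
by case: (s : bool) => /=; ring.
Qed.

Lemma sum_weight_derangements n :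
  \sum_(s in derangements n.+1) weight s =
  (-1) ^+ n * \sum_(1 <= j < n.+1)
     (\prod_(0 <= i < j) y i) * (\prod_(j <= i < n.+1) x i).
Proof.
elim: n => [|n IHn].
  rewrite [X in _ * X]big_geq // mulr0 big_pred0 // => s.
  by rewrite inE; apply/negbTE/forallPn; exists ord0; rewrite ord1 eqxx.
have -> : \sum_(s in derangements n.+2) weight s =
    \sum_(s in quasi_derangements n.+1) weight s
    - \sum_(s in derangements n.+1) x n.+1 * weight s.
  rewrite [X in _ = X - _](bigID (fun s : 'S_n.+2 => s ord_max == ord_max)) /=.
  rewrite (big_lift_perm _ ord_max ord_max (mem (quasi_derangements n.+1))) /=.
  under eq_bigl => s do rewrite derangementsE.
  under [X in _ = X + _ - _]eq_bigl => s do rewrite lift_perm_max_quasi.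
  under [X in _ = X + _ - _]eq_bigr => s _ do rewrite weight_lift_perm_max.
  by ring.
under eq_bigr => s _ do rewrite weight_core.
rewrite -!big_distrr /= IHn sum_core_weight.
(* The term [j = n.+1] comes from [sum_core_weight]; the others share the factor [x n.+1] and match
   the induction hypothesis. *)
rewrite [in RHS]big_nat_recr //= big_nat1.
under [X in _ = _ * (X + _)]eq_big_nat => j /andP[_ jn] do
  rewrite (big_nat_recr n.+1) ?(ltnW jn) //= mulrA.
by rewrite -big_distrl /= exprS; ring.
Qed.

End Weights.

Lemma sum_RLMi_EXCi (R : comNzRingType) n (x y : 'I_n.+1 -> R) :
  \sum_(s in derangements n.+1) (-1) ^+ inv_number s *
    (\prod_(i in RLMi s) x i) * (\prod_(i in EXCi s) y i) =
  (-1) ^+ n * \sum_(1 <= j < n.+1)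
     (\prod_(i < n.+1 | (i < j)%N) y i) * (\prod_(i < n.+1 | (j <= i)%N) x i).
Proof.
(* The default value of [inord] beyond [n] is harmless: every index that occurs is at most [n]. *)
pose nat_fun (z : 'I_n.+1 -> R) k := z (inord k).
transitivity (\sum_(s in derangements n.+1) weight (nat_fun x) (nat_fun y) s).
  apply: eq_bigr => s _; rewrite /weight -signr_odd odd_inv_number.
  by congr (_ * _ * _); apply: eq_bigr => i _; rewrite /nat_fun inord_val.
rewrite sum_weight_derangements; congr (_ * _).
rewrite big_nat_cond [RHS]big_nat_cond; apply: eq_bigr => j /andP[/andP[_ jn] _].
congr (_ * _).
  rewrite (big_nat_widen _ _ n.+1) 1?ltnW // big_mkord.
  by apply: eq_bigr => i _; rewrite /nat_fun inord_val.
rewrite (big_nat_widenl _ 0) // big_mkord.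
by apply: eq_bigr => i _; rewrite /nat_fun inord_val.
Qed.

(** * Conjugating the inverse by the reversal *)

Section ReverseComplementInverse.
Variable n : nat.
Implicit Type s : 'S_n.

Definition rev_perm : 'S_n := perm (@rev_ord_inj n).

Definition rci s : 'S_n := (rev_perm * s^-1 * rev_perm)%g.

Lemma rciE s i : rci s i = rev_ord (s^-1 (rev_ord i))%g.
Proof. by rewrite !permM !permE. Qed.

Lemma rciK : involutive rci.
Proof. by move=> s; rewrite /rci !invMg invgK mulKVg mulgKV. Qed.

Lemma odd_rci s : odd_perm (rci s) = odd_perm s.
Proof. by rewrite !odd_permM odd_permV addbC addKb. Qed.

Lemma rci_derangements s : (rci s \in derangements n) = (s \in derangements n).
Proof.
rewrite !inE; apply/forallP/forallP => der i; apply/eqP => eq_i.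
  by have := der (rev_ord i); rewrite rciE rev_ordK -{1}eq_i permK eqxx.
move: eq_i; rewrite rciE => /(canRL rev_ordK) eq_i.
by have := der (rev_ord i); rewrite -{1}eq_i permKV eqxx.
Qed.

(** A value is a right-to-left minimum when all smaller values lie to its left, that is, when it is
    the position of a left-to-right maximum of the inverse; reversal turns these into right-to-left
    minima. *)
Lemma RLMi_rci s i : (i \in RLMi (rci s)) = (rev_ord i \in RLMv s).
Proof.
rewrite -(permKV s (rev_ord i)) mem_imset; last exact: perm_inj.
rewrite !inE; apply/forallP/forallP => rlm j; apply/implyP => lt_j.
  have := implyP (rlm (rev_ord (s j))); rewrite !rciE rev_ordK permK permKV /=.
  have := ltn_ord (s j); have := ltn_ord i; have := ltn_ord j.
  case: (eqVneq (s j) (rev_ord i)) lt_j => [<-|]; first by rewrite permK ltnn.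
  by rewrite -val_eqE /=; lia.
have := implyP (rlm (s^-1 (rev_ord j))%g); rewrite !rciE !permKV /=.
have := ltn_ord (s^-1 (rev_ord i))%g; have := ltn_ord (s^-1 (rev_ord j))%g.
have : (s^-1)%g (rev_ord i) != (s^-1)%g (rev_ord j).
  by rewrite !(inj_eq perm_inj, inj_eq rev_ord_inj) -val_eqE /= ltn_eqF.
by rewrite -val_eqE /=; have := ltn_ord i; have := ltn_ord j; lia.
Qed.

Lemma EXCi_rci s i : (i \in EXCi (rci s)) = (rev_ord i \in EXCv s).
Proof.
rewrite -(permKV s (rev_ord i)) mem_imset; last exact: perm_inj.
rewrite !inE rciE permKV /=.
by have := ltn_ord i; have := ltn_ord (s^-1 (rev_ord i))%g; lia.
Qed.

End ReverseComplementInverse.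

Lemma sum_RLMv_EXCv (R : comNzRingType) n (x y : 'I_n.+1 -> R) :
  \sum_(s in derangements n.+1) (-1) ^+ inv_number s *
    (\prod_(i in RLMv s) x i) * (\prod_(i in EXCv s) y i) =
  (-1) ^+ n * \sum_(1 <= j < n.+1)
     (\prod_(i < n.+1 | (i < j)%N) x i) * (\prod_(i < n.+1 | (j <= i)%N) y i).
Proof.
have := sum_RLMi_EXCi (x \o @rev_ord _) (y \o @rev_ord _).
rewrite (reindex_inj (inv_inj (@rciK _))) /=.
under eq_bigl => s do rewrite rci_derangements.
under eq_bigr => s _.
  rewrite -signr_odd odd_inv_number odd_rci -odd_inv_number signr_odd.
  under eq_bigl => i do rewrite RLMi_rci.
  rewrite -(reindex_inj rev_ord_inj (P := mem (RLMv s)) (F := x)).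
  under [X in _ * X]eq_bigl => i do rewrite EXCi_rci.
  rewrite -(reindex_inj rev_ord_inj (P := mem (EXCv s)) (F := y)).
over.
(* Reversing the variables exchanges initial and final segments, so [j] is replaced by
   [n.+1 - j]. *)
move=> /= ->; congr (_ * _); rewrite big_nat_rev add1n /=.
rewrite big_nat_cond [RHS]big_nat_cond; apply: eq_bigr => j.
move=> /andP[/andP[j_gt0 j_lt] _]; rewrite subSS mulrC.
by congr (_ * _); rewrite [RHS](reindex_inj rev_ord_inj) /=;
   apply: eq_bigl => i; have := ltn_ord i; lia.
Qed.

(* With the 0-based indices of 'I_n, the factors x_1 ... x_j are those with
   index i < j and the factors y_(j+1) ... y_n those with index j <= i. *)
Theorem theorem22 (R : comNzRingType) (n : nat) (hn : (1 <= n)%N) :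
  \sum_(s in derangements n)
      (-1) ^+ inv_number s * Xmon R (RLMv s) * Ymon R (EXCv s)
    = (-1) ^+ (n - 1) *
      \sum_(1 <= j < n)
         (\prod_(i < n | (i < j)%N) Xvar R i) *
         (\prod_(i < n | (j <= i)%N) Yvar R i)
  /\
  \sum_(s in derangements n)
      (-1) ^+ inv_number s * Xmon R (RLMi s) * Ymon R (EXCi s)
    = (-1) ^+ (n - 1) *
      \sum_(1 <= j < n)
         (\prod_(i < n | (i < j)%N) Yvar R i) *
         (\prod_(i < n | (j <= i)%N) Xvar R i).
Proof.
case: n hn => // n _; rewrite subn1 /=.
by split; [exact: sum_RLMv_EXCv | exact: sum_RLMi_EXCi].
Qed.
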